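(* Let $f:V\to W$ be a linear isomorphism between (finite dimensional real) vector spaces endowed with linear generalized complex structures $L_V$ and $L_W$, respectively. Then the following assertions are equivalent: (i) $f$ is generalized complex linear. (ii) $f_*(L_V)=L_W$, up to linear $B$-field transformations.
   Context: For $E\subseteq V^{\mathbb C}$ and $\varepsilon\in\Lambda^2E^*$, $L(E,\varepsilon)=\{u+\alpha\in V^{\mathbb C}\oplus(V^{\mathbb C})^*\mid u\in E,\ \alpha|_E=\varepsilon(u,\cdot)\}$. A linear generalized complex structure on a real vector space $V$ is a maximal isotropic subspace $L$ of $V^{\mathbb C}\oplus(V^{\mathbb C})^*$ (for $\langle u+\alpha,v+\beta\rangle=\tfrac12(\alpha(v)+\beta(u))$) with $L\cap\overline L=\{0\}$. Then $L=L(E,\varepsilon)$ for a unique pair, $E+\overline E=V^{\mathbb C}$ and the real two-form $\mathrm{Im}(\varepsilon|_{E\cap\overline E})$, on the real subspace of $V$ whose complexification is $E\cap\overline E$, is nondegenerate. The associated linear co-CR structure is $E$; the associated linear Poisson structure on $V$ is $L\bigl(E\cap\overline E,\mathrm{Im}(\varepsilon|_{E\cap\overline E})\bigr)$ (regarded on the underlying real subspace), which is the graph of a bivector on $V$. A linear map $f:V\to W$ is generalized complex linear if $f(E_V)\subseteq E_W$ (co-CR linear) and $f$ maps the bivector of the associated Poisson structure of $L_V$ to that of $L_W$ (linear Poisson morphism). Push forward: $f_*(L_V)=\{f(X)+\xi\mid X+f^*(\xi)\in L_V\}$ ($f$ extended complex linearly). A linear $B$-field transformation given by a real two-form $b$ is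 $\exp(b)(u+\alpha)=u+b(u,\cdot)+\alpha$. Thus (ii) means $\exp(b)(f_*(L_V))=L_W$ for some real two-form $b$ on $W$. *)

(* Defs.v *)
From HB Require Import structures.
From mathcomp Require Import all_boot all_order all_algebra.
From mathcomp Require Import all_classical reals.
From mathcomp Require Import complex.

Set Implicit Arguments.
Unset Strict Implicit.
Unset Printing Implicit Defensive.

Import Order.TTheory GRing.Theory Num.Theory.
Local Open Scope classical_set_scope.
Local Open Scope ring_scope.
Local Open Scope complex_scope.

Notation dual U := 'Hom(U, (GRing.regular _)).

(* A bilinear form beta on U is stored as the map u |-> beta(u, .). *)
Notation bilform U := 'Hom(U, dual U).

(* The element u + alpha of U (+) U^* is the pair (u, alpha). *)
Notation gvec U := (U * dual U)%type.

Section LinearDirac.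
Variables (K : fieldType) (U : vectType K).

Definition pairing (x y : gvec U) : K := 2%:R^-1 * (x.2 y.1 + y.2 x.1).

Definition isotropic (L : {vspace gvec U}) : Prop :=
  forall x y, x \in L -> y \in L -> pairing x y = 0.

Definition maximal_isotropic (L : {vspace gvec U}) : Prop :=
  isotropic L /\
  forall M : {vspace gvec U}, isotropic M -> (L <= M)%VS -> M = L.

Definition alternating (beta : bilform U) : Prop := forall u, beta u u = 0.

(* L(E, eps): the condition alpha|_E = eps(u, .) is tested on vectors of the
   type subvs_of E; vsproj E u is u itself, seen in E, when u \in E. *)
Definition Lform (E : {vspace U}) (eps : bilform (subvs_of E)) :
    set (gvec U) :=
  [set x : gvec U | x.1 \in E /\
     forall v : subvs_of E, x.2 (vsval v) = eps (vsproj E x.1) v].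

(* A bivector pi on U is an alternating form on U^*; its graph consists of the
   pi(xi, .) + xi, with pi(xi, .) in U^** = U. *)
Definition bivector_graph (pi : bilform (dual U)) : set (gvec U) :=
  [set x : gvec U | forall eta : dual U, eta x.1 = pi x.2 eta].

End LinearDirac.

(* The pair (x, y) stands for x + i y. *)
Definition cplx (R : rcfType) (V : vectType R) : Type := (V * V)%type.

Section Complexification.
Variables (R : rcfType) (V : vectType R).

HB.instance Definition _ := GRing.Zmodule.copy (cplx V) (V * V)%type.

Definition cplx_scale (a : R[i]) (u : cplx V) : cplx V :=
  (complex.Re a *: u.1 - complex.Im a *: u.2,
   complex.Re a *: u.2 + complex.Im a *: u.1).

Fact cplx_scalerA a b u : cplx_scale a (cplx_scale b u) = cplx_scale (a * b) u.
Proof.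
case: a b u => [a a'] [b b'] [x y]; rewrite /cplx_scale /=.
congr (_, _); rewrite !(scalerBr, scalerDr, scalerA, scalerBl, scalerDl) ?opprD.
  by rewrite (AC (2*2) ((1*4)*(2*3))).
by rewrite (AC (2*2) ((1*4)*(2*3))).
Qed.

Fact cplx_scale1r : left_id 1 cplx_scale.
Proof. by case=> x y; rewrite /cplx_scale /= !scale1r !scale0r subr0 addr0. Qed.

Fact cplx_scalerDr : right_distributive cplx_scale +%R.
Proof.
move=> [a a'] [x y] [z t]; rewrite /cplx_scale /=.
by congr (_, _); rewrite /= !scalerDr ?opprD addrACA.
Qed.

Fact cplx_scalerDl u : {morph cplx_scale^~ u : a b / a + b >-> a + b}.
Proof.
move=> [a a'] [b b']; case: u => x y; rewrite /cplx_scale /=.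
by congr (_, _); rewrite /= !scalerDl ?opprD addrACA.
Qed.

HB.instance Definition _ := GRing.Zmodule_isLmodule.Build R[i] (cplx V)
  cplx_scalerA cplx_scale1r cplx_scalerDr cplx_scalerDl.

Import VectorInternalTheory.

Fact cplx_vect_axiom : Vector.axiom (dim V) (cplx V).
Proof.
exists (fun u : cplx V => \row_j (v2r u.1 0 j +i* v2r u.2 0 j)).
  move=> [a a'] [x y] [z t]; apply/rowP=> j; rewrite !mxE /=.
  by rewrite !linearD !linearN !linearZ !mxE mulrN; simpc.
exists (fun r : 'rV_(dim V) =>
  (r2v (\row_j complex.Re (r 0 j)), r2v (\row_j complex.Im (r 0 j)))).
  move=> [x y] /=; congr (_, _).
    by rewrite -[RHS]v2rK; congr r2v; apply/rowP=> j; rewrite !mxE.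
  by rewrite -[RHS]v2rK; congr r2v; apply/rowP=> j; rewrite !mxE.
by move=> r; apply/rowP=> j; rewrite !mxE /= !r2vK !mxE; case: (r 0 j).
Qed.

HB.instance Definition _ :=
  Lmodule_hasFinDim.Build R[i] (cplx V) cplx_vect_axiom.

End Complexification.

Section RealStructure.
Variables (R : rcfType) (V : vectType R).

Definition cplx_of (v : V) : cplx V := (v, 0).

Definition cplx_conj (u : cplx V) : cplx V := (u.1, - u.2).

(* The conjugate functional u |-> conj (alpha (conj u)). *)
Definition dual_conj_fun (alpha : dual (cplx V)) (u : cplx V) : R[i]^o :=
  conjc (alpha (cplx_conj u)).

Fact dual_conj_is_linear alpha : linear (dual_conj_fun alpha).
Proof.
move=> a u v; rewrite /dual_conj_fun.
have -> : cplx_conj (a *: u + v) = conjc a *: cplx_conj u + cplx_conj v.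
  case: a u v => [a a'] [x y] [z t]; congr (_, _) => /=.
    by rewrite scalerN scaleNr opprK.
  by rewrite scalerN scaleNr !opprD.
have -> : alpha (conjc a *: cplx_conj u + cplx_conj v) =
          conjc a * alpha (cplx_conj u) + alpha (cplx_conj v) :> R[i].
  by rewrite linearP.
case: a (alpha (cplx_conj u)) (alpha (cplx_conj v)) => [a a'] [p p'] [q q'].
by apply/eqP; rewrite eq_complex /= !(mulrN, mulNr, opprD, opprK) !eqxx.
Qed.

HB.instance Definition _ alpha :=
  GRing.isLinear.Build R[i] (cplx V) R[i]^o _ _ (dual_conj_is_linear alpha).

Definition dual_conj (alpha : dual (cplx V)) : dual (cplx V) :=
  linfun (dual_conj_fun alpha).

Definition gconj (x : gvec (cplx V)) : gvec (cplx V) :=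
  (cplx_conj x.1, dual_conj x.2).

(* The complex linear extension of a real functional. *)
Definition dual_cplx_fun (alpha : dual V) (u : cplx V) : R[i]^o :=
  alpha u.1 +i* alpha u.2.

Fact dual_cplx_is_linear alpha : linear (dual_cplx_fun alpha).
Proof.
move=> [a a'] [x y] [z t]; rewrite /dual_cplx_fun.
by apply/eqP; rewrite eq_complex /= !linearD !linearN !linearZ /= !eqxx.
Qed.

HB.instance Definition _ alpha :=
  GRing.isLinear.Build R[i] (cplx V) R[i]^o _ _ (dual_cplx_is_linear alpha).

Definition dual_cplx (alpha : dual V) : dual (cplx V) :=
  linfun (dual_cplx_fun alpha).

(* b(u, .) for the complex bilinear extension of a real form b:
   b(x + i y, .) = b(x, .) + i b(y, .). *)
Definition form_cplx (b : bilform V) (u : cplx V) : dual (cplx V) :=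
  dual_cplx (b u.1) + 'i *: dual_cplx (b u.2).

Definition exp_form (b : bilform V) (x : gvec (cplx V)) : gvec (cplx V) :=
  (x.1, form_cplx b x.1 + x.2).

(* F^C, for a real subspace F of V. *)
Definition vspace_cplx (F : {vspace V}) : set (cplx V) :=
  [set u : cplx V | u.1 \in F /\ u.2 \in F].

End RealStructure.

Section ComplexifiedMap.
Variables (R : rcfType) (V W : vectType R) (f : 'Hom(V, W)).

Definition hom_cplx_fun (u : cplx V) : cplx W := (f u.1, f u.2).

Fact hom_cplx_is_linear : linear hom_cplx_fun.
Proof.
move=> [a a'] [x y] [z t]; rewrite /hom_cplx_fun /=.
by congr (_, _); rewrite /= !linearD ?linearN !linearZ.
Qed.

HB.instance Definition _ :=
  GRing.isLinear.Build R[i] (cplx V) (cplx W) _ _ hom_cplx_is_linear.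

Definition hom_cplx : 'Hom(cplx V, cplx W) := linfun hom_cplx_fun.

(* f_*(L) = {f(X) + xi | X + f^* xi \in L}. *)
Definition pushforward (L : set (gvec (cplx V))) : set (gvec (cplx W)) :=
  [set y : gvec (cplx W) | exists X : cplx V,
     L (X, (y.2 \o hom_cplx)%VF) /\ y.1 = hom_cplx X].

Definition bivector_pushforward (pi : bilform (dual V)) (xi eta : dual W) : R :=
  pi (xi \o f)%VF (eta \o f)%VF.

End ComplexifiedMap.

Section GeneralizedComplex.
Variables (R : rcfType) (V : vectType R).

Definition gen_complex (L : {vspace gvec (cplx V)}) : Prop :=
  maximal_isotropic L /\
  [set` L] `&` (@gconj R V @` [set` L]) = [set 0].

(* E is the linear co-CR structure of L: L = L(E, eps) for some eps. *)
Definition coCR_of (L : {vspace gvec (cplx V)}) (E : {vspace cplx V}) : Prop :=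
  exists eps : bilform (subvs_of E),
    alternating eps /\ [set` L] = Lform eps.

(* The bivector pi of the linear Poisson structure L(F, Im (eps|_F)) of
   L = L(E, eps), where F is the real subspace with F^C = E `&` conj E. *)
Definition poisson_of (L : {vspace gvec (cplx V)}) (pi : bilform (dual V)) :
    Prop :=
  exists (E : {vspace cplx V}) (eps : bilform (subvs_of E))
         (F : {vspace V}) (om : bilform (subvs_of F)),
    [/\ alternating eps /\ [set` L] = Lform eps,
        vspace_cplx F = [set` E] `&` (@cplx_conj R V @` [set` E]),
        alternating om /\ forall u v : subvs_of F,
          om u v = complex.Im (eps (vsproj E (cplx_of (vsval u)))
                                   (vsproj E (cplx_of (vsval v)))) &
        alternating pi /\ bivector_graph pi = Lform om].

End GeneralizedComplex.

Section GeneralizedComplexMap.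
Variables (R : rcfType) (V W : vectType R) (f : 'Hom(V, W)).
Variables (LV : {vspace gvec (cplx V)}) (LW : {vspace gvec (cplx W)}).

Definition coCR_linear : Prop :=
  exists (EV : {vspace cplx V}) (EW : {vspace cplx W}),
    [/\ coCR_of LV EV, coCR_of LW EW & (hom_cplx f @: EV <= EW)%VS].

Definition poisson_morphism : Prop :=
  exists (piV : bilform (dual V)) (piW : bilform (dual W)),
    [/\ poisson_of LV piV, poisson_of LW piW &
        forall xi eta : dual W, bivector_pushforward f piV xi eta = piW xi eta].

Definition gen_complex_linear : Prop := coCR_linear /\ poisson_morphism.

End GeneralizedComplexMap.

(* Main.v *)
(* Write E for the projection of L to V^C.  Maximality forces Ann(E) into L,
   hence L is its own orthogonal and, as L meets its conjugate trivially,
   V^C (+) (V^C)^* = L (+) conj L.  Decomposing the real covectors (0, xi) yields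
   an intrinsic description of the associated bivector, free of E and eps:
   its graph consists of the real pairs (x, xi) such that (x, alpha) is in L for
   some alpha with Im alpha = xi on V.  This relation is visibly unchanged by
   B-fields, as is E, which gives (ii) => (i).

   For (i) => (ii), push L_V forward to W.  Equality of the bivectors gives equal
   real points of the two co-CR structures, so the inclusion of E_V in E_W is
   an equality, and the difference d of the two complex two-forms on E is real on
   the real points of E.  With p a projection onto E preserving conj E, pb its
   conjugate and q = p + pb - 1, the form
     b(u, v) = d(p u, p v) + conj d(conj (pb u), conj (pb v)) - d(q u, q v)
   is real and restricts to d on E, because p u = u and q u = pb u there. *)

From HB Require Import structures.
Require Import Defs.
From mathcomp Require Import all_boot all_order all_algebra.
From mathcomp Require Import all_classical reals complex ring.

Set Implicit Arguments.
Unset Strict Implicit.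
Unset Printing Implicit Defensive.

Import Order.TTheory GRing.Theory Num.Theory.
Local Open Scope classical_set_scope.
Local Open Scope ring_scope.
Local Open Scope complex_scope.

(** * Separation by functionals and reflexivity in finite dimension *)

Section LinearAlgebra.
Variables (K : fieldType).
Implicit Types (U T : vectType K).

Lemma exists_hom U T (g : U -> T) : linear g -> exists h : 'Hom(U, T), h =1 g.
Proof.
move=> glin; pose a := GRing.isLinear.Build K U T _ g glin.
pose G : {linear U -> T} := HB.pack g a.
by exists (linfun G) => x; rewrite lfunE.
Qed.

Lemma exists_bilform U (g : U -> U -> K) :
  (forall v, linear ((g^~ v) : U -> K^o)) ->
  (forall u, linear (g u : U -> K^o)) ->
  exists beta : bilform U, forall u v, beta u v = g u v.
Proof.
move=> gl gr.
have /choice[h hE] u := exists_hom (gr u).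
have hl : linear (h : U -> dual U).
  move=> a u v; apply/lfunP => w.
  by rewrite !lfunE /= lfunE /= !hE; exact: (gl w).
by have [beta bE] := exists_hom hl; exists beta => u v; rewrite bE hE.
Qed.

Import VectorInternalTheory.

(** The coordinates of [x - projv S x] are functionals of [x] that vanish on [S]. *)
Lemma memv_separated U (S : {vspace U}) x :
  (forall eta : dual U, (forall s, s \in S -> eta s = 0) -> eta x = 0) ->
  x \in S.
Proof.
move=> h; suff -> : x = projv S x by exact: memv_proj.
apply/eqP; rewrite -subr_eq0; apply/eqP.
apply: (can_inj v2rK); rewrite [RHS]linear0; apply/rowP => j; rewrite [RHS]mxE.
have glin : linear ((fun u => v2r (u - projv S u) 0 j) : U -> K^o).
  by move=> a u v; rewrite linearP opprD addrACA -scalerBr linearP !mxE.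
have [eta etaE] := exists_hom glin.
rewrite -etaE; apply: h => s sS.
by rewrite etaE projv_id // subrr linear0 mxE.
Qed.

Lemma dual_separated U (x : U) : (forall eta : dual U, eta x = 0) -> x = 0.
Proof.
by move=> h; apply/eqP; rewrite -memv0; apply: memv_separated => eta _.
Qed.

Lemma bidual_eval U (phi : dual (dual U)) :
  exists w : U, forall eta : dual U, phi eta = eta w.
Proof.
pose X := vbasis (fullv : {vspace U}).
have clin (i : 'I_(\dim (fullv : {vspace U}))) :
    linear (coord X i : U -> K^o).
  by move=> a u v; rewrite linearP.
have /choice[c cE] i := exists_hom (clin i).
(* The [c i] form the dual basis of [X], so the coordinates of the vector representing [phi] are the
   [phi (c i)]. *)
exists (\sum_(i < \dim (fullv : {vspace U})) (phi (c i) : K) *: X`_i) => eta.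
have etaE : eta = \sum_(i < \dim (fullv : {vspace U})) (eta X`_i : K) *: c i.
  apply/lfunP => v; rewrite sum_lfunE [in LHS](coord_vbasis (memvf v)).
  rewrite linear_sum; apply: eq_bigr => i _.
  by rewrite linearZ /= lfunE /= cE; exact: mulrC.
rewrite {1}etaE !linear_sum; apply: eq_bigr => i _.
by rewrite !linearZ; exact: mulrC.
Qed.

End LinearAlgebra.

(** * Maximal isotropic subspaces *)

Section Isotropic.
Variables (K : numFieldType) (U : vectType K).
Implicit Types (L M : {vspace gvec U}) (x y : gvec U).

Lemma pairing_eq0 x y : pairing x y = 0 <-> x.2 y.1 + y.2 x.1 = 0.
Proof.
rewrite /pairing; split => [/eqP|->]; last by rewrite mulr0.
by rewrite mulf_eq0 invr_eq0 pnatr_eq0 => /eqP.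
Qed.

Lemma pairingC x y : pairing x y = pairing y x.
Proof. by rewrite /pairing addrC. Qed.

Lemma pairingDr x y z : pairing x (y + z) = pairing x y + pairing x z.
Proof.
by rewrite /pairing /= linearD add_lfunE -mulrDr addrACA.
Qed.

Lemma pairingZr a x y : pairing x (a *: y) = a * pairing x y.
Proof.
rewrite /pairing /= linearZ scale_lfunE mulrCA; congr (_ * _).
by rewrite mulrDr.
Qed.

(** For L = L(E, eps) this is E; see [Lform_anchor]. *)
Definition anchor L : {vspace U} := (linfun (fst : gvec U -> U) @: L)%VS.

Lemma mem_anchor L x : x \in L -> x.1 \in anchor L.
Proof.
by move=> xL; rewrite -[x.1](lfunE (fst : {linear gvec U -> U})) memv_img.
Qed.

Lemma anchorP L u : u \in anchor L <-> exists alpha : dual U, (u, alpha) \in L.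
Proof.
split => [/memv_imgP[[v alpha] vL ->]|[alpha uL]]; last exact: mem_anchor uL.
by exists alpha; rewrite lfunE.
Qed.

(** A linear right inverse of the projection from L to E picks the lifts. It yields a form on all of
    [U] that represents eps on E, so later arguments can avoid the type [subvs_of E]. *)
Lemma anchor_section L :
  exists a : bilform U, forall u, u \in anchor L -> (u, a u) \in L.
Proof.
pose g := (linfun (fst : gvec U -> U) \o projv L)%VF.
exists (linfun (snd : gvec U -> dual U) \o projv L \o g^-1)%VF => u.
have -> : anchor L = limg g by rewrite limg_comp -/(limg (projv L)) limg_proj.
move=> /limg_lfunVK; rewrite !comp_lfunE /= !lfunE /=.
set p := projv L _ => uE; rewrite -{1}uE.
suff : p \in L by case: p {uE}.
exact: memv_proj.
Qed.

(** The vector [(0, alpha)] is orthogonal to L and to itself, so adjoining it keeps L isotropic and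
    maximality applies. *)
Lemma isotropic_annihilator L (alpha : dual U) : maximal_isotropic L ->
  (forall u, u \in anchor L -> alpha u = 0) -> (0, alpha) \in L.
Proof.
case=> isoL maxL alpha0; set x := (0, alpha).
have xL y : y \in L -> pairing x y = 0.
  move=> yL; apply/pairing_eq0 => /=.
  by rewrite linear0 addr0 alpha0 ?mem_anchor.
have xx : pairing x x = 0 by apply/pairing_eq0; rewrite /= linear0 addr0.
suff <- : (L + <[x]>)%VS = L.
  exact: (subvP (addvSr L _)) (memv_line x).
apply: maxL; last exact: addvSl.
move=> _ _ /memv_addP[y yL [_ /vlineP[a ->] ->]]
           /memv_addP[z zL [_ /vlineP[b ->] ->]].
rewrite pairingDr pairingZr 2!(pairingC (y + _)) !pairingDr !pairingZr.
by rewrite xx xL // (pairingC z x) xL // isoL // !(mulr0, addr0).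
Qed.

(** Orthogonality to the covectors in Ann(E) puts [x.1] in E. Then [x] differs from any lift of
    [x.1] in L by a covector that annihilates E. *)
Lemma isotropic_perp L x : maximal_isotropic L ->
  (forall y, y \in L -> pairing x y = 0) -> x \in L.
Proof.
move=> mL xL; have uE : x.1 \in anchor L.
  apply: memv_separated => eta eta0.
  have /xL/pairing_eq0/= := isotropic_annihilator mL eta0.
  by rewrite linear0 add0r.
have [alpha aL] := (anchorP _ _).1 uE.
have /(isotropic_annihilator mL) dL v :
    v \in anchor L -> (x.2 - alpha : dual U) v = 0.
  move=> /anchorP[beta bL]; rewrite add_lfunE opp_lfunE.
  have /pairing_eq0/= e1 := xL _ bL.
  have /pairing_eq0/= e2 := mL.1 _ _ aL bL.
  by apply/eqP; rewrite subr_eq0; apply/eqP/(addIr (beta x.1)); rewrite e1 e2.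
suff -> : x = (x.1, alpha) + (0, x.2 - alpha) by exact: memvD.
by case: x {xL uE aL dL} => u xi; congr (_, _); rewrite /= ?addr0 // addrC subrK.
Qed.

(** Membership in L can be tested against a single known lift, since the lifts of one vector form a
    coset of Ann(E). *)
Lemma maximal_isotropicP L x (alpha : dual U) : maximal_isotropic L ->
  (x.1, alpha) \in L ->
  x \in L <-> forall v, v \in anchor L -> x.2 v = alpha v.
Proof.
move=> mL aL; split => [xL v /anchorP[beta bL]|h].
  have /pairing_eq0/= e1 := mL.1 _ _ xL bL.
  have /pairing_eq0/= e2 := mL.1 _ _ aL bL.
  by apply: (addIr (beta x.1)); rewrite e1.
suff -> : x = (x.1, alpha) + (0, x.2 - alpha).
  apply: memvD => //; apply: isotropic_annihilator => // v vE.
  by rewrite add_lfunE opp_lfunE h // subrr.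
by case: x {aL h} => u xi; congr (_, _); rewrite /= ?addr0 // addrC subrK.
Qed.

(** By reflexivity every functional on U + U^* is twice the pairing with some [(w, alpha)]. If it
    vanishes on [S], then [(w, alpha)] is orthogonal to [S], hence zero. *)
Lemma nondegenerate_full (S : {vspace gvec U}) :
  (forall x, (forall y, y \in S -> pairing x y = 0) -> x = 0) ->
  S = fullv.
Proof.
move=> S0; apply/eqP; rewrite eqEsubv subvf; apply/subvP => x _.
apply: memv_separated => phi phi0.
have l1 : linear ((fun u => phi (u, 0)) : U -> K^o).
  move=> a u v; rewrite -linearP; congr (phi _).
  by congr (_, _); rewrite /= scaler0 addr0.
have l2 : linear ((fun eta => phi (0, eta)) : dual U -> K^o).
  move=> a u v; rewrite -linearP; congr (phi _).
  by congr (_, _); rewrite /= scaler0 addr0.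
have [alpha alphaE] := exists_hom l1; have [psi psiE] := exists_hom l2.
have [w wE] := bidual_eval psi.
have phiE y : phi y = alpha y.1 + y.2 w.
  rewrite -wE alphaE psiE -linearD; congr (phi _).
  by case: y => u eta; congr (_, _); rewrite /= ?addr0 ?add0r.
have [w0 a0] : (w, alpha) = 0 :> gvec U.
  by apply: S0 => y /phi0; rewrite phiE => e; exact/pairing_eq0.
by rewrite phiE w0 a0 lfunE linear0 addr0.
Qed.

End Isotropic.

(** * Antilinear involutions and real structures *)

Section Conjugation.
Variable R : rcfType.

(** The image of [S] under [c] is a kernel: u lies in it when [c u] equals its projection to [S].
    The outer [c] in the map below restores complex linearity. *)
Lemma conj_vspace (U : vectType R[i]) (c : U -> U) (S : {vspace U}) :
  (forall a u v, c (a *: u + v) = conjc a *: c u + c v) -> involutive c ->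
  exists T : {vspace U}, forall u, (u \in T) = (c u \in S).
Proof.
move=> clin cK.
have glin : linear (fun u => c (c u - projv S (c u))).
  move=> a u v; rewrite clin linearP opprD addrACA -scalerBr clin.
  by rewrite conjcK.
have c0 : c 0 = 0.
  by have := clin (-1) 0 0; rewrite scaler0 addr0 rmorphN1 scaleN1r addNr.
have [g gE] := exists_hom glin; exists (lker g) => u.
rewrite memv_ker gE -c0 (inj_eq (inv_inj cK)) subr_eq0.
by apply/eqP/idP => [->|/projv_id ->//]; exact: memv_proj.
Qed.

Variable V : vectType R.
Implicit Types (u v : cplx V) (x y : gvec (cplx V)) (z : R[i]).

Lemma cplxE u : u = cplx_of u.1 + 'i *: cplx_of u.2.
Proof.
case: u => x y; apply/pair_equal_spec => /=.
by rewrite !scaler0 !scale0r !scale1r subrr !add0r !addr0.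
Qed.

Lemma cplx_ofP (a : R) (x y : V) :
  cplx_of (a *: x + y) = a%:C *: cplx_of x + cplx_of y.
Proof. by apply/pair_equal_spec; rewrite /= !scaler0 scale0r subr0 !addr0. Qed.

Lemma cplx_conj_antilinear a u v :
  cplx_conj (a *: u + v) = conjc a *: cplx_conj u + cplx_conj v.
Proof.
case: a u v => [a a'] [x y] [z t]; apply/pair_equal_spec => /=.
by rewrite !scalerN !scaleNr !opprK !opprD.
Qed.

Lemma cplx_conjK : involutive (@cplx_conj R V).
Proof. by case=> x y; rewrite /cplx_conj /= opprK. Qed.

Lemma cplx_conj_of (x : V) : cplx_conj (cplx_of x) = cplx_of x.
Proof. by rewrite /cplx_conj /= oppr0. Qed.

Lemma dual_conjE (alpha : dual (cplx V)) u :
  dual_conj alpha u = conjc (alpha (cplx_conj u)).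
Proof. by rewrite lfunE. Qed.

Lemma gconj_antilinear a x y :
  gconj (a *: x + y) = conjc a *: gconj x + gconj y.
Proof.
apply/pair_equal_spec; split; first exact: cplx_conj_antilinear.
apply/lfunP => u; rewrite add_lfunE scale_lfunE !dual_conjE add_lfunE.
by rewrite scale_lfunE rmorphD; congr (_ + _); exact: rmorphM.
Qed.

Lemma gconjK : involutive (@gconj R V).
Proof.
case=> u alpha; apply/pair_equal_spec; split; first exact: cplx_conjK.
by apply/lfunP => v; rewrite !dual_conjE conjcK cplx_conjK.
Qed.

Lemma pairing_gconj x y : pairing (gconj x) (gconj y) = conjc (pairing x y).
Proof.
rewrite /pairing /= !dual_conjE !cplx_conjK.
by rewrite rmorphM rmorphD fmorphV rmorph_nat.
Qed.

Lemma dual_cplx_of (xi : dual V) (x : V) : dual_cplx xi (cplx_of x) = (xi x)%:C.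
Proof. by rewrite lfunE /= /dual_cplx_fun /= linear0. Qed.

Lemma dual_eq_on_real (alpha beta : dual (cplx V)) :
  (forall x : V, alpha (cplx_of x) = beta (cplx_of x)) -> alpha = beta.
Proof.
by move=> h; apply/lfunP => u; rewrite (cplxE u) !linearD !linearZ /= !h.
Qed.

Lemma ReD z w : complex.Re (z + w) = complex.Re z + complex.Re w.
Proof. by case: z w => [a b] []. Qed.

Lemma ImD z w : complex.Im (z + w) = complex.Im z + complex.Im w.
Proof. by case: z w => [a b] []. Qed.

Lemma ImN z : complex.Im (- z) = - complex.Im z.
Proof. by case: z. Qed.

Lemma ImiM z : complex.Im ('i * z) = complex.Re z.
Proof. by case: z => a b /=; rewrite mul0r mul1r add0r. Qed.

Lemma ImrM (a : R) z : complex.Im (a%:C * z) = a * complex.Im z.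
Proof. by case: z => b c /=; rewrite mul0r addr0. Qed.

Lemma Re_conjc z : complex.Re (conjc z) = complex.Re z.
Proof. by case: z. Qed.

Lemma Im_conjc z : complex.Im (conjc z) = - complex.Im z.
Proof. by case: z. Qed.

Lemma Im0_real z : complex.Im z = 0 -> conjc z = z.
Proof. by case: z => a b /= ->; rewrite oppr0. Qed.

Lemma exists_im (alpha : dual (cplx V)) :
  exists xi : dual V, forall x : V, xi x = complex.Im (alpha (cplx_of x)).
Proof.
have glin : linear ((fun x : V => complex.Im (alpha (cplx_of x))) : V -> R^o).
  by move=> a x y; rewrite cplx_ofP linearP ImD; congr (_ + _); exact: ImrM.
exact: exists_hom glin.
Qed.

End Conjugation.

(** * The intrinsic description of the associated bivector *)

Section PoissonRelation.
Variables (R : rcfType) (V : vectType R).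
Implicit Types (L : {vspace gvec (cplx V)}) (x y : V) (xi eta : dual V).

(* The graph of the Poisson bivector of L; see [poisson_ofP]. *)
Definition poisson_rel L x xi : Prop :=
  exists alpha : dual (cplx V), (cplx_of x, alpha) \in L /\
    forall v : V, complex.Im (alpha (cplx_of v)) = xi v.

Variable L : {vspace gvec (cplx V)}.
Hypothesis gcL : gen_complex L.

Let maxL : maximal_isotropic L := gcL.1.

Lemma gen_complex_gconj z : z \in L -> gconj z \in L -> z = 0.
Proof.
move=> zL zcL; have : ([set` L] `&` (@gconj R V @` [set` L])) z.
  by split=> //=; exists (gconj z) => //; exact: gconjK.
by rewrite gcL.2.
Qed.

(** A vector orthogonal to L + conj L lies in L together with its conjugate, hence is zero;
    nondegeneracy of the pairing does the rest. *)
Lemma gen_complex_decomp z :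
  exists a b, [/\ a \in L, b \in L & z = a + gconj b].
Proof.
have [L' L'E] := conj_vspace L (@gconj_antilinear R V) (@gconjK R V).
have full : (L + L')%VS = fullv.
  apply: nondegenerate_full => w w0; apply: gen_complex_gconj.
    apply: isotropic_perp => // y yL; apply: w0.
    exact: (subvP (addvSl _ _)).
  apply: isotropic_perp => // y yL.
  have yL' : gconj y \in (L + L')%VS.
    by apply: (subvP (addvSr _ _)); rewrite L'E gconjK.
  by rewrite -[y]gconjK pairing_gconj w0 ?rmorph0.
have /memv_addP[a aL [b bL' ->]] : z \in (L + L')%VS by rewrite full memvf.
by exists a, (gconj b); rewrite gconjK -L'E.
Qed.

Lemma anchor_decomp (u : cplx V) :
  exists a b, [/\ a \in anchor L, b \in anchor L & u = a + cplx_conj b].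
Proof.
have [a [b [aL bL e]]] := gen_complex_decomp (u, 0).
exists a.1, b.1; split; [exact: mem_anchor|exact: mem_anchor|].
by case: e.
Qed.

Lemma poisson_rel_lin (a : R) x y xi eta :
  poisson_rel L x xi -> poisson_rel L y eta ->
  poisson_rel L (a *: x + y) (a *: xi + eta).
Proof.
move=> [al [alL alE]] [be [beL beE]]; exists (a%:C *: al + be); split.
  suff -> : (cplx_of (a *: x + y), a%:C *: al + be) =
    a%:C *: ((cplx_of x, al) : gvec (cplx V)) + (cplx_of y, be).
    by rewrite memvD ?memvZ.
  by apply/pair_equal_spec; split; first exact: cplx_ofP.
move=> v; rewrite !add_lfunE !scale_lfunE ImD beE; congr (_ + _).
by rewrite -alE; exact: ImrM.
Qed.

Lemma poisson_rel_total xi : exists x, poisson_rel L x xi.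
Proof.
have [a [b [aL bL]]] := gen_complex_decomp (0, dual_cplx xi).
case: a b aL bL => [[a1 a2] al] [[b1 b2] be] aL bL.
move=> /pair_equal_spec[/= /pair_equal_spec[/= e1 e2] e3].
(* Since a + conj b has zero vector part, a + b has a purely imaginary one, and i(a + b) lies over a
   real vector. On real [v], Im of i(al + be) is Re(al + be) = Re(al + conj be), which is [xi v]. *)
exists (- (a2 + b2)), ('i *: (al + be)); split.
  suff -> : (cplx_of (- (a2 + b2)), 'i *: (al + be)) =
    'i *: (((a1, a2), al) + ((b1, b2), be) : gvec (cplx V)).
    by rewrite memvZ ?memvD.
  apply/pair_equal_spec; split=> //; apply/pair_equal_spec => /=.
  by rewrite !scale0r !scale1r !add0r -e1.
move=> v; have /(congr1 (@complex.Re R)) :=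
  congr1 (fun h : dual (cplx V) => h (cplx_of v)) e3.
rewrite dual_cplx_of add_lfunE dual_conjE cplx_conj_of ReD Re_conjc /= => ->.
by rewrite scale_lfunE add_lfunE [LHS]ImiM ReD.
Qed.

(** The difference of the two lifts has a real vector part and a real covector part, so it is fixed
    by conjugation and lies in L and conj L. *)
Lemma poisson_rel_inj x y xi :
  poisson_rel L x xi -> poisson_rel L y xi -> x = y.
Proof.
move=> xr yr; have [al [alL alE]] := poisson_rel_lin (-1) yr xr.
apply/eqP; rewrite -subr_eq0 addrC -scaleN1r; apply/eqP.
move: alL alE; rewrite scaleN1r (scaleN1r xi) addNr => alL alE.
have gE : gconj (cplx_of (- y + x), al) = (cplx_of (- y + x), al); last first.
  by have := gen_complex_gconj alL; rewrite gE => /(_ alL)[].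
apply/pair_equal_spec; split; first exact: cplx_conj_of.
apply: dual_eq_on_real => v; rewrite dual_conjE cplx_conj_of.
by apply: Im0_real; rewrite alE lfunE.
Qed.

(** The bivector thus determines the real points of E: any lift of a real point supplies [xi] as its
    imaginary part. *)
Lemma poisson_rel_fst x :
  cplx_of x \in anchor L <-> exists xi, poisson_rel L x xi.
Proof.
split=> [/anchorP[al alL]|[xi [al [alL _]]]]; last exact: mem_anchor alL.
by have [xi xiE] := exists_im al; exists xi, al; split=> // v; rewrite xiE.
Qed.

Lemma poisson_rel_isotropic x y xi eta :
  poisson_rel L x xi -> poisson_rel L y eta -> xi y + eta x = 0.
Proof.
move=> [al [alL alE]] [be [beL beE]].
have /pairing_eq0/= e := maxL.1 _ _ alL beL.
by rewrite -alE -beE -ImD e.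
Qed.

(** Testing on the real points of E alone is the form in which L(F, Im eps) is given. It suffices
    because totality gives a [y] truly related to [xi], and isotropy against lifts over real points
    shows that no functional separates [x] from [y]. *)
Lemma poisson_relP x xi :
  poisson_rel L x xi <->
  exists2 al, (cplx_of x, al) \in L &
    forall v : V, cplx_of v \in anchor L ->
      complex.Im (al (cplx_of v)) = xi v.
Proof.
split=> [[al [alL alE]]|[al alL alE]]; first by exists al.
have [y yr] := poisson_rel_total xi; suff -> : x = y by [].
apply/eqP; rewrite -subr_eq0; apply/eqP; apply: dual_separated => eta.
have [z [ga [gaL gaE]]] := poisson_rel_total eta.
have [be [beL beE]] := yr.
have /pairing_eq0/= e1 := maxL.1 _ _ alL gaL.
have /pairing_eq0/= e2 := maxL.1 _ _ beL gaL.
have zE := mem_anchor gaL.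
rewrite linearB /= -!gaE; apply/eqP; rewrite subr_eq0; apply/eqP.
apply: (addrI (xi z)); rewrite -{1}alE // -beE.
by rewrite -!ImD e1 e2.
Qed.

End PoissonRelation.

(** * The presentation L = L(E, eps) *)

Section LformAnchor.
Variables (K : numFieldType) (U : vectType K).
Implicit Types (L : {vspace gvec U}).

Lemma Lform_mem L (E : {vspace U}) (eps : bilform (subvs_of E)) x :
  [set` L] = Lform eps ->
  x \in L <-> x.1 \in E /\
     forall v : subvs_of E, x.2 (vsval v) = eps (vsproj E x.1) v.
Proof.
move=> LE; have -> : (x \in L) = [set` L] x :> Prop by [].
by rewrite LE.
Qed.

Lemma Lform_anchor L (E : {vspace U}) (eps : bilform (subvs_of E)) :
  [set` L] = Lform eps -> E = anchor L.
Proof.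
move=> LE; apply/vspaceP => u; apply/idP/idP => [uE|/anchorP[al]]; last first.
  by move=> /(Lform_mem _ LE)[].
(* The covector eps(u, .) on E is extended to [U] through the projection onto E. *)
apply/anchorP; exists (eps (vsproj E u) \o linfun (vsproj E))%VF.
by apply/(Lform_mem _ LE); split=> //= v; rewrite !lfunE /= lfunE /= vsvalK.
Qed.

(** The form eps is the restriction to E of a linear section of L; isotropy of each lift with itself
    makes it alternating. *)
Lemma maximal_isotropic_Lform L : maximal_isotropic L ->
  exists eps : bilform (subvs_of (anchor L)),
    alternating eps /\ [set` L] = Lform eps.
Proof.
move=> mL; have [a aL] := anchor_section L.
have [eps epsE] : exists eps : bilform (subvs_of (anchor L)),
    forall u v, eps u v = a (vsval u) (vsval v).
  apply: exists_bilform => [v|u] k u1 u2; rewrite !linearP //.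
  by rewrite add_lfunE scale_lfunE.
exists eps; split=> [u|].
  have /pairing_eq0/= := mL.1 _ _ (aL _ (subvsP u)) (aL _ (subvsP u)).
  by rewrite epsE -mulr2n => /eqP; rewrite mulrn_eq0 /= => /eqP.
have main x : x.1 \in anchor L -> (x \in L <->
    forall v : subvs_of (anchor L), x.2 (vsval v) = eps (vsproj _ x.1) v).
  move=> xE; split=> [xL v|h].
    rewrite epsE vsprojK //.
    exact: (maximal_isotropicP mL (aL _ xE)).1 xL _ (subvsP v).
  apply/(maximal_isotropicP mL (aL _ xE)) => v vE.
  by have := h (vsproj _ v); rewrite epsE !vsprojK.
apply/seteqP; split=> x /= => [xL|[xE]]; last by move/main; apply.
by have xE := mem_anchor xL; split=> //; apply/main.
Qed.

End LformAnchor.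

(** * The co-CR and Poisson structures in intrinsic terms *)

Section AssociatedStructures.
Variables (R : rcfType) (V : vectType R) (L : {vspace gvec (cplx V)}).
Hypothesis gcL : gen_complex L.
Let maxL : maximal_isotropic L := gcL.1.

Lemma coCR_ofP (E : {vspace cplx V}) : coCR_of L E <-> E = anchor L.
Proof.
split=> [[eps [_ /Lform_anchor]]//|->].
exact: maximal_isotropic_Lform.
Qed.

(** The subspace is cut out by the real and imaginary components of [g], both real linear in [x]. *)
Lemma real_points (E : {vspace cplx V}) :
  exists F : {vspace V}, forall x, (x \in F) = (cplx_of x \in E).
Proof.
pose g x := projv E (cplx_of x) - cplx_of x.
have gP (a : R) x y : g (a *: x + y) = a%:C *: g x + g y.
  by rewrite /g cplx_ofP linearP opprD addrACA -scalerBr.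
have g1 : linear (fun x => (g x).1).
  by move=> a x y; rewrite gP /= scale0r subr0.
have g2 : linear (fun x => (g x).2).
  by move=> a x y; rewrite gP /= scale0r addr0.
have [h1 h1E] := exists_hom g1; have [h2 h2E] := exists_hom g2.
exists (lker h1 :&: lker h2)%VS => x; rewrite memv_cap !memv_ker h1E h2E.
transitivity (g x == 0); first by case: (g x).
rewrite subr_eq0; apply/eqP/idP => [<-|/projv_id //]; exact: memv_proj.
Qed.

Lemma Re_Im_mem (E : {vspace cplx V}) u : u \in E -> cplx_conj u \in E ->
  cplx_of u.1 \in E /\ cplx_of u.2 \in E.
Proof.
move=> uE ucE.
have e1 : 2%:R *: cplx_of u.1 = u + cplx_conj u.
  rewrite scaler_nat mulr2n; apply/pair_equal_spec => /=.
  by rewrite addr0 subrr.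
have e2 : (2%:R * 'i) *: cplx_of u.2 = u - cplx_conj u.
  rewrite -scalerA scaler_nat mulr2n; apply/pair_equal_spec => /=.
  by rewrite !(subrr, opprK, scaler0, scale0r, scale1r, add0r, oppr0).
have two : (2%:R : R[i]) != 0 by rewrite pnatr_eq0.
have i0 : 2%:R * 'i != 0 :> R[i] by rewrite mulf_neq0 ?neq0Ci.
split; [rewrite -[cplx_of u.1](scalerK two) e1
       |rewrite -[cplx_of u.2](scalerK i0) e2]; apply: memvZ.
  exact: memvD.
exact: memvB.
Qed.

(** The intersection of E and conj E is stable under conjugation, so it contains the real and
    imaginary parts of its elements. *)
Lemma vspace_cplx_real_points (E : {vspace cplx V}) (F : {vspace V}) :
  (forall x, (x \in F) = (cplx_of x \in E)) <->
  vspace_cplx F = [set` E] `&` (@cplx_conj R V @` [set` E]).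
Proof.
split=> [FE|FE x]; last first.
  have -> : (cplx_of x \in E) =
      `[< ([set` E] `&` (@cplx_conj R V @` [set` E])) (cplx_of x) >].
    apply/idP/asboolP => [xE|[]//]; split=> //.
    by exists (cplx_of x) => //; exact: cplx_conj_of.
  rewrite -FE; apply/idP/asboolP => [xF|[]//].
  by split=> //=; exact: mem0v.
apply/seteqP; split=> u /=.
  case; rewrite !FE => u1 u2; split; first by rewrite (cplxE u) memvD ?memvZ.
  exists (cplx_conj u); last exact: cplx_conjK.
  rewrite (cplxE u) addrC cplx_conj_antilinear !cplx_conj_of.
  by rewrite /= memvD ?memvZ.
case=> uE [v vE vu]; have ucE : cplx_conj u \in E by rewrite -vu cplx_conjK.
by have [u1 u2] := Re_Im_mem uE ucE; split; rewrite FE.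
Qed.

(** Being total and single-valued, the relation is the graph of a linear map [g] from V^* to V; the
    bivector is pi(xi, eta) = eta(g xi), alternating by isotropy. *)
Lemma exists_poisson_bivector :
  exists pi : bilform (dual V), alternating pi /\
    forall x xi, bivector_graph pi (x, xi) <-> poisson_rel L x xi.
Proof.
have /choice[g gP] := poisson_rel_total gcL.
have glin : linear g.
  move=> a xi eta; apply: poisson_rel_inj (gP _) _ => //.
  exact: poisson_rel_lin.
have [pi piE] : exists pi : bilform (dual V),
    forall xi eta, pi xi eta = eta (g xi).
  apply: exists_bilform => [eta|xi] a x y; first by rewrite glin linearP.
  by rewrite add_lfunE scale_lfunE.
exists pi; split=> [xi|x xi].
  have := poisson_rel_isotropic gcL (gP xi) (gP xi).
  by rewrite piE -mulr2n => /eqP; rewrite mulrn_eq0 /= => /eqP.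
split=> [h|xr eta /=]; last by rewrite piE (poisson_rel_inj gcL xr (gP xi)).
suff -> : x = g xi by exact: gP.
apply/eqP; rewrite -subr_eq0; apply/eqP/dual_separated => eta.
by rewrite linearB /= (h eta) piE subrr.
Qed.

Lemma Lform_poisson_rel (eps : bilform (subvs_of (anchor L))) (F : {vspace V})
    (om : bilform (subvs_of F)) :
  [set` L] = Lform eps ->
  (forall x, (x \in F) = (cplx_of x \in anchor L)) ->
  (forall u v : subvs_of F,
     om u v = complex.Im (eps (vsproj _ (cplx_of (vsval u)))
                              (vsproj _ (cplx_of (vsval v))))) ->
  forall x xi, Lform om (x, xi) <-> poisson_rel L x xi.
Proof.
(* For any lift [al] of [x] in L, om(x, .) is Im [al] on F, so the condition of [Lform om] becomes
   that of [poisson_relP]. *)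
move=> LE FE omE x xi; have omE' al v : x \in F -> v \in F ->
    (cplx_of x, al) \in L -> om (vsproj F x) (vsproj F v) =
    complex.Im (al (cplx_of v)).
  move=> xF vF /(Lform_mem _ LE)[/= xE].
  move=> /(_ (vsproj _ (cplx_of v))); rewrite vsprojK -?FE // => ->.
  by rewrite omE !vsprojK.
split=> [[/= xF h]|/(poisson_relP gcL)[al alL alE]].
  apply/(poisson_relP gcL).
  have /anchorP[al alL] : cplx_of x \in anchor L by rewrite -FE.
  exists al => // v; rewrite -FE => vF.
  by rewrite -(omE' al) // -h vsprojK.
have xF : x \in F by rewrite FE; exact: mem_anchor alL.
split=> //= v; rewrite -alE -?FE ?subvsP //.
by rewrite -(omE' al) ?subvsP // vsvalK.
Qed.

(** E is forced to be the anchor and F to consist of its real points, so the auxiliary data of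
    [poisson_of] can be discarded. *)
Lemma poisson_ofP (pi : bilform (dual V)) :
  poisson_of L pi <-> alternating pi /\
    forall x xi, bivector_graph pi (x, xi) <-> poisson_rel L x xi.
Proof.
split=> [[E [eps [F [om [[epsA LE] FE [omA omE] [piA piE]]]]]]|[piA piE]].
  split=> // x xi; have EE := Lform_anchor LE; subst E.
  rewrite piE; apply: (Lform_poisson_rel LE) omE x xi.
  exact/vspace_cplx_real_points.
have [eps [epsA LE]] := maximal_isotropic_Lform maxL.
have [F FE] := real_points (anchor L).
have [om omE] : exists om : bilform (subvs_of F), forall u v : subvs_of F,
     om u v = complex.Im (eps (vsproj _ (cplx_of (vsval u)))
                              (vsproj _ (cplx_of (vsval v)))).
  apply: exists_bilform => [v|u] a x y; rewrite linearP cplx_ofP linearP.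
    rewrite linearP add_lfunE scale_lfunE ImD; congr (_ + _); exact: ImrM.
  by rewrite linearP ImD; congr (_ + _); exact: ImrM.
exists (anchor L), eps, F, om; split=> //.
- exact/vspace_cplx_real_points.
- by split=> // u; rewrite omE epsA.
split=> //; apply/seteqP; split=> -[x xi].
  by move=> /piE/(Lform_poisson_rel LE FE omE).
by move=> /(Lform_poisson_rel LE FE omE)/piE.
Qed.

End AssociatedStructures.

(** * Real two-forms and their action *)

Section BField.
Variables (R : rcfType) (V : vectType R).
Implicit Types (L : {vspace gvec (cplx V)}) (b : bilform V).

Lemma form_cplx_of b (x y : V) :
  form_cplx b (cplx_of x) (cplx_of y) = (b x y)%:C.
Proof.
rewrite /form_cplx add_lfunE scale_lfunE !dual_cplx_of linear0 lfunE.
by rewrite scaler0 addr0.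
Qed.

Lemma form_cplxE b (B : bilform (cplx V)) :
  (forall x y, B (cplx_of x) (cplx_of y) = (b x y)%:C) ->
  forall u, form_cplx b u = B u.
Proof.
move=> BE u; apply: dual_eq_on_real => x.
rewrite [in RHS](cplxE u) linearD linearZ.
by rewrite /form_cplx !add_lfunE !scale_lfunE /= !dual_cplx_of !BE.
Qed.

Lemma exists_real_form (B : bilform (cplx V)) :
  (forall x y, complex.Im (B (cplx_of x) (cplx_of y)) = 0) ->
  exists b, forall u, form_cplx b u = B u.
Proof.
move=> B0.
have [b bE] : exists b, forall x y,
    b x y = complex.Re (B (cplx_of x) (cplx_of y)).
  have ReZ (a : R) z : complex.Re (a%:C * z) = a * complex.Re z.
    by case: z => c d /=; rewrite mul0r subr0.
  apply: exists_bilform => [y|x] a x1 x2; rewrite cplx_ofP linearP.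
    by rewrite add_lfunE scale_lfunE ReD; congr (_ + _); exact: ReZ.
  by rewrite ReD; congr (_ + _); exact: ReZ.
exists b => u; apply: form_cplxE => x y; rewrite bE.
by case: (B _ _) (B0 x y) => c d /= ->.
Qed.

Lemma exp_form_anchor b L1 L2 :
  exp_form b @` [set` L1] = [set` L2] -> anchor L2 = anchor L1.
Proof.
move=> L12; apply/vspaceP => u; apply/idP/idP => /anchorP[al].
  move=> alL; have : [set` L2] (u, al) by [].
  by rewrite -L12 => -[z zL] [<- _]; exact: mem_anchor.
move=> alL; have : [set` L2] (exp_form b (u, al)).
  by rewrite -L12; exists (u, al).
by move/mem_anchor.
Qed.

(** At a real [x] the covector added by exp(b) is real on V, so imaginary parts are unchanged. *)
Lemma exp_form_poisson_rel b L1 L2 x xi :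
  exp_form b @` [set` L1] = [set` L2] ->
  poisson_rel L1 x xi <-> poisson_rel L2 x xi.
Proof.
move=> L12; split=> [[al [alL alE]]|[be [beL beE]]].
  exists (form_cplx b (cplx_of x) + al); split.
    have : [set` L2] (exp_form b (cplx_of x, al)).
      by rewrite -L12; exists (cplx_of x, al).
    by [].
  by move=> v; rewrite add_lfunE form_cplx_of ImD /= add0r.
have : [set` L2] (cplx_of x, be) by [].
rewrite -L12 => -[[u al] alL] /pair_equal_spec[/= ux bex].
subst u be; exists al; split=> // v.
by rewrite -beE add_lfunE form_cplx_of ImD /= add0r.
Qed.

(** * Two structures with the same bivector *)

Section SamePoisson.
Variables L1 L2 : {vspace gvec (cplx V)}.
Hypotheses (gc1 : gen_complex L1) (gc2 : gen_complex L2).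
Hypothesis P12 : forall x xi, poisson_rel L1 x xi <-> poisson_rel L2 x xi.

Let E := anchor L1.

(** Write u = a + conj c with a, c in E1. Then c and conj c both lie in E2, so the real and
    imaginary parts of c are real points of E2, which are real points of E1 by [P12]. *)
Lemma anchor_eq : (anchor L1 <= anchor L2)%VS -> anchor L1 = anchor L2.
Proof.
move=> sE12; apply/eqP; rewrite eqEsubv sE12; apply/subvP => u uE2.
have [a [c [aE cE ue]]] := anchor_decomp gc1 u.
suff cE1 : cplx_conj c \in anchor L1 by rewrite ue memvD.
have cE2 : cplx_conj c \in anchor L2.
  have -> : cplx_conj c = u - a by rewrite ue addrC addKr.
  by rewrite memvB // (subvP sE12).
have [x1E x2E] : cplx_of c.1 \in anchor L1 /\ cplx_of c.2 \in anchor L1.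
  have [c1 c2] := Re_Im_mem (subvP sE12 _ cE) cE2.
  by split; apply/poisson_rel_fst;
    [have [xi] := (poisson_rel_fst _ _).1 c1
    |have [xi] := (poisson_rel_fst _ _).1 c2]; exists xi; apply/P12.
by rewrite (cplxE c) addrC cplx_conj_antilinear !cplx_conj_of memvD ?memvZ.
Qed.

Hypothesis E12 : E = anchor L2.
Variable d : bilform (cplx V).

(** On E, [d] is the two-form of [L2] minus that of [L1]; off E it is unconstrained. *)
Hypothesis dE : forall u al be, (u, al) \in L1 -> (u, be) \in L2 ->
  forall v, v \in E -> d u v = be v - al v.

Lemma diff_alternating u : u \in E -> d u u = 0.
Proof.
move=> uE; have [al alL] := (anchorP _ _).1 uE.
have /anchorP[be beL] : u \in anchor L2 by rewrite -E12.
have half (c : R[i]) : c + c = 0 -> c = 0.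
  by rewrite -mulr2n => /eqP; rewrite mulrn_eq0 /= => /eqP.
have /pairing_eq0/half/= e1 := gc1.1.1 _ _ alL alL.
have /pairing_eq0/half/= e2 := gc2.1.1 _ _ beL beL.
by rewrite (dE alL beL) // e1 e2 subrr.
Qed.

(** Equality of the bivectors provides lifts of [x] in [L1] and [L2] with the same imaginary part
    [xi], which cancels in the difference. *)
Lemma diff_real x y : cplx_of x \in E -> cplx_of y \in E ->
  complex.Im (d (cplx_of x) (cplx_of y)) = 0.
Proof.
move=> /poisson_rel_fst[xi xr] yE.
have [al [alL alE]] := xr; have [be [beL beE]] := (P12 _ _).1 xr.
by rewrite (dE alL beL) // ImD ImN alE beE subrr.
Qed.

(** Expand over real and imaginary parts: these are real points of E, where [d] takes real
    values. *)
Lemma diff_conj u v : u \in E -> cplx_conj u \in E ->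
  v \in E -> cplx_conj v \in E ->
  d (cplx_conj u) (cplx_conj v) = conjc (d u v).
Proof.
move=> uE ucE vE vcE.
have [u1 u2] := Re_Im_mem uE ucE; have [v1 v2] := Re_Im_mem vE vcE.
have cE (w : cplx V) : cplx_conj w = cplx_of w.1 + conjc 'i *: cplx_of w.2.
  by rewrite [in LHS](cplxE w) addrC cplx_conj_antilinear !cplx_conj_of addrC.
have expand z : d (cplx_of u.1 + z *: cplx_of u.2)
                  (cplx_of v.1 + z *: cplx_of v.2) =
    d (cplx_of u.1) (cplx_of v.1) + z * d (cplx_of u.2) (cplx_of v.1) +
    z * (d (cplx_of u.1) (cplx_of v.2) + z * d (cplx_of u.2) (cplx_of v.2)).
  by rewrite linearD linearZ /= linearD linearZ /= !add_lfunE !scale_lfunE.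
have dR x y xE yE := Im0_real (@diff_real x y xE yE).
rewrite !cE [in RHS](cplxE u) [in RHS](cplxE v) !expand.
by rewrite !(rmorphD, rmorphM) /= !dR.
Qed.

Lemma exists_real_extension : exists b,
  alternating b /\ forall u v, u \in E -> v \in E -> form_cplx b u v = d u v.
Proof.
have [Eb EbE] := conj_vspace E (@cplx_conj_antilinear R V) (@cplx_conjK R V).
(* The sum conj E + E need not be direct. [addv_pi2] assigns the overlap to E, so [p] is the
   identity on E, and u - p u lies in conj E, so [p] preserves conj E. *)
pose p := addv_pi2 Eb E.
have pE u : p u \in E by exact: memv_pi2.
have p_id u : u \in E -> p u = u by move=> uE; rewrite /p addv_pi2_id.
have pEb u : u \in Eb -> p u \in Eb.
  move=> uEb; have e : addv_pi1 Eb E u + p u = u.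
    by apply: addv_pi1_pi2; exact: (subvP (addvSl _ _)).
  have -> : p u = u - addv_pi1 Eb E u by rewrite -{2}e addrC addKr.
  by rewrite memvB ?memv_pi1.
(* p projects onto E and preserves conj E, pb is the conjugate projection onto
   conj E, and q projects onto E :&: conj E. *)
pose pb u := cplx_conj (p (cplx_conj u)).
pose q u := p u + pb u - u.
have pb_lin a u v : pb (a *: u + v) = a *: pb u + pb v.
  by rewrite /pb cplx_conj_antilinear linearP cplx_conj_antilinear conjcK.
have p_lin a u v : p (a *: u + v) = a *: p u + p v by rewrite linearP.
have q_lin a u v : q (a *: u + v) = a *: q u + q v.
  rewrite /q linearP pb_lin /= scalerBr scalerDr opprD.
  by rewrite [X in X + _ = _]addrACA; exact: addrACA.
have pbE u : u \in E -> pb u \in E.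
  by move=> uE; rewrite /pb -EbE pEb // EbE cplx_conjK.
(* For u = a + conj c with a, c in E, [pb] fixes conj c, hence q u = p u + pb a - a, and [pb]
   preserves E. *)
have qE u : q u \in E.
  have [a [c [aE cE ->]]] := anchor_decomp gc1 u.
  have := pb_lin 1 a (cplx_conj c).
  rewrite /q !scale1r => ->; rewrite {2}/pb cplx_conjK (p_id c) // opprD.
  by rewrite -addrA [X in _ + X]addrACA subrr addr0 memvD ?memvB ?pE ?pbE.
have q_real x : q (cplx_of x) = cplx_of (q (cplx_of x)).1.
  apply/pair_equal_spec; split=> //=.
  by rewrite cplx_conj_of subrr subr0.
have dl a u v w : d (a *: u + v) w = a * d u w + d v w.
  by rewrite linearP add_lfunE scale_lfunE.
have dr a u v w : d u (a *: v + w) = a * d u v + d u w by rewrite linearP.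
have assoc (a x1 x2 y1 y2 z1 z2 : R[i]) :
    a * x1 + x2 + (a * y1 + y2) - (a * z1 + z2) =
    a * (x1 + y1 - z1) + (x2 + y2 - z2) by ring.
have [B BE] : exists B : bilform (cplx V), forall u v, B u v =
    d (p u) (p v) + conjc (d (p (cplx_conj u)) (p (cplx_conj v)))
    - d (q u) (q v).
  apply: exists_bilform => [v|u] a u1 u2;
    rewrite cplx_conj_antilinear !p_lin q_lin.
    rewrite !dl !(rmorphD, rmorphM) /= conjcK.
    exact: assoc.
  rewrite !dr !(rmorphD, rmorphM) /= conjcK.
  exact: assoc.
(* At real x, y the first two terms of [B] are conjugate to each other, while q x and q y are real
   points of E, where [diff_real] applies. *)
have [b bE] : exists b, forall u, form_cplx b u = B u.
  apply: exists_real_form => x y; rewrite BE !cplx_conj_of q_real (q_real y).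
  by rewrite !ImD ImN diff_real -?q_real // Im_conjc subrr subr0.
exists b; split=> [x|u v uE vE].
  have : (b x x)%:C = 0 :> R[i].
    rewrite -form_cplx_of bE BE !cplx_conj_of !diff_alternating //.
    by rewrite conjc0 addr0 subr0.
  by case.
(* On E the last two terms of [B] cancel: pb w and its conjugate both lie in E, so [diff_conj] turns
   the conjugated term into d(pb u, pb v). *)
have q_pb w : w \in E -> q w = pb w.
  by move=> wE; rewrite /q p_id // addrAC subrr add0r.
have pcE w : w \in E -> cplx_conj (pb w) \in E.
  by rewrite /pb cplx_conjK.
rewrite bE BE (p_id u) // (p_id v) // !q_pb // -diff_conj ?pbE ?pcE //.
exact: addrK.
Qed.

End SamePoisson.

End BField.

Lemma same_poisson_bfield (R : rcfType) (V : vectType R)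
    (L1 L2 : {vspace gvec (cplx V)}) :
  gen_complex L1 -> gen_complex L2 -> (anchor L1 <= anchor L2)%VS ->
  (forall x xi, poisson_rel L1 x xi <-> poisson_rel L2 x xi) ->
  exists b : bilform V,
    alternating b /\ exp_form b @` [set` L1] = [set` L2].
Proof.
move=> gc1 gc2 sE12 P12; have E12 := anchor_eq gc1 P12 sE12.
have [a1 a1L] := anchor_section L1; have [a2 a2L] := anchor_section L2.
(* The difference of linear sections of [L2] and [L1] serves as [d]; on E its values do not depend
   on the lifts chosen. *)
have dE u al be : (u, al) \in L1 -> (u, be) \in L2 ->
    forall v, v \in anchor L1 -> (a2 - a1) u v = be v - al v.
  move=> alL beL v vE; rewrite !add_lfunE !opp_lfunE.
  have h1 := (maximal_isotropicP gc1.1 (a1L _ (mem_anchor alL))).1 alL.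
  have h2 := (maximal_isotropicP gc2.1 (a2L _ (mem_anchor beL))).1 beL.
  by rewrite -h1 //= -h2 // -E12.
have [b [bA bE]] := exists_real_extension gc1 gc2 P12 E12 dE.
exists b; split=> //; apply/seteqP; split=> [_ [[u al] alL <-]|[u be] beL] /=.
  have uE := mem_anchor alL; have [|be beL] := (anchorP L2 u).1.
    by rewrite -E12.
  apply/(@maximal_isotropicP _ _ _ _ be gc2.1) => //= v; rewrite -E12 => vE.
  by rewrite add_lfunE bE // (dE _ _ _ alL beL) //; exact: subrK.
have uE : u \in anchor L1 by rewrite E12; exact: mem_anchor beL.
exists (u, be - form_cplx b u); last first.
  by apply/pair_equal_spec; split=> //=; rewrite addrC subrK.
have [al alL] := (anchorP L1 u).1 uE.
apply/(@maximal_isotropicP _ _ _ _ al gc1.1) => //= v vE.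
rewrite add_lfunE opp_lfunE bE // (dE _ _ _ alL beL) // opprB.
by rewrite addrC; exact: subrK.
Qed.

(** * Transport along a linear isomorphism *)

Section Transport.
Variable R : rcfType.
Implicit Types V W : vectType R.

(** With [g] inverse to [f] this is f + (f^-1)^*. Keeping [g] as an argument makes [gmap g f] the
    inverse map. *)
Definition gmap V W (f : 'Hom(V, W)) (g : 'Hom(W, V)) (x : gvec (cplx V)) :
    gvec (cplx W) :=
  (hom_cplx f x.1, (x.2 \o hom_cplx g)%VF).

Lemma hom_cplxE V W (f : 'Hom(V, W)) u : hom_cplx f u = (f u.1, f u.2).
Proof. by rewrite lfunE. Qed.

Lemma hom_cplxK V W (f : 'Hom(V, W)) (g : 'Hom(W, V)) :
  cancel f g -> cancel (hom_cplx f) (hom_cplx g).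
Proof. by move=> fK [x y]; rewrite !hom_cplxE /= !fK. Qed.

Lemma gmap_linear V W (f : 'Hom(V, W)) (g : 'Hom(W, V)) : linear (gmap f g).
Proof.
move=> a x y; apply/pair_equal_spec; split; first by rewrite /= linearP.
by rewrite /= comp_lfunDl comp_lfunZl.
Qed.

Lemma gmapK V W (f : 'Hom(V, W)) (g : 'Hom(W, V)) :
  cancel f g -> cancel (gmap f g) (gmap g f).
Proof.
move=> fK [u al]; apply/pair_equal_spec; split; first exact: hom_cplxK.
by apply/lfunP => v; rewrite !comp_lfunE hom_cplxK.
Qed.

Lemma pairing_gmap V W (f : 'Hom(V, W)) (g : 'Hom(W, V)) x y :
  cancel f g -> pairing (gmap f g x) (gmap f g y) = pairing x y.
Proof. by move=> fK; rewrite /pairing /= !comp_lfunE !hom_cplxK. Qed.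

Lemma gconj_gmap V W (f : 'Hom(V, W)) (g : 'Hom(W, V)) x :
  gconj (gmap f g x) = gmap f g (gconj x).
Proof.
have cE U T (h : 'Hom(U : vectType R, T : vectType R)) u :
    cplx_conj (hom_cplx h u) = hom_cplx h (cplx_conj u).
  by rewrite !hom_cplxE /cplx_conj /= linearN.
apply/pair_equal_spec; split; first exact: cE.
by apply/lfunP => v; rewrite comp_lfunE !dual_conjE comp_lfunE cE.
Qed.

Lemma gmap_vspace V W (f : 'Hom(V, W)) (g : 'Hom(W, V))
    (L : {vspace gvec (cplx W)}) :
  exists M : {vspace gvec (cplx V)}, forall x, (x \in M) = (gmap f g x \in L).
Proof.
have [h hE] := exists_hom (gmap_linear f g).
by exists (h @^-1: L)%VS => x; rewrite -memv_preim hE.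
Qed.

Variables (V W : vectType R) (f : 'Hom(V, W)) (g : 'Hom(W, V)).
Hypotheses (fK : cancel f g) (gK : cancel g f).

(** The bijection [gmap f g] preserves the pairing and commutes with conjugation; an isotropic space
    containing [M] is pulled back to V to use the maximality of [L]. *)
Lemma gmap_gen_complex (L : {vspace gvec (cplx V)})
    (M : {vspace gvec (cplx W)}) :
  gen_complex L -> (forall y, (y \in M) = (gmap g f y \in L)) -> gen_complex M.
Proof.
move=> [[isoL maxL] L0] ME; split; first split.
- by move=> x y; rewrite !ME => xL yL; rewrite -(pairing_gmap _ _ gK) isoL.
- move=> N isoN sMN; have [L' L'E] := gmap_vspace f g N.
  have L'L : L' = L.
    apply: maxL => [x y|].
      by rewrite !L'E => xN yN; rewrite -(pairing_gmap _ _ fK) isoN.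
    by apply/subvP => x xL; rewrite L'E (subvP sMN) // ME gmapK.
  by apply/vspaceP => y; rewrite ME -L'L L'E gmapK.
apply/seteqP; split=> [y [/= yM [z /= zM zy]]|_ ->]; last first.
  split=> /=; first exact: mem0v.
  exists 0; first exact: mem0v.
  apply/pair_equal_spec; split; first by rewrite /cplx_conj /= oppr0.
  by apply/lfunP => u; rewrite dual_conjE !lfunE; exact: conjc0.
have : ([set` L] `&` (@gconj R V @` [set` L])) (gmap g f y).
  split=> /=; first by rewrite -ME.
  by exists (gmap g f z); [rewrite /= -ME | rewrite gconj_gmap zy].
rewrite L0 /= => y0; rewrite -[y](gmapK gK) y0.
by apply/pair_equal_spec; rewrite /= linear0 comp_lfun0l.
Qed.

Lemma gmap_anchor (L : {vspace gvec (cplx V)}) (M : {vspace gvec (cplx W)}) :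
  (forall y, (y \in M) = (gmap g f y \in L)) ->
  anchor M = (hom_cplx f @: anchor L)%VS.
Proof.
move=> ME; apply/vspaceP => u; apply/idP/memv_imgP => [|[v]].
  move=> /anchorP[al]; rewrite ME => /mem_anchor/= uE.
  by exists (hom_cplx g u); rewrite ?hom_cplxK.
move=> /anchorP[al alL] ->; apply/anchorP; exists (al \o hom_cplx g)%VF.
by rewrite ME -[(_, _)]/(gmap f g (v, al)) gmapK.
Qed.

Lemma gmap_poisson_rel (L : {vspace gvec (cplx V)})
    (M : {vspace gvec (cplx W)}) x xi :
  (forall y, (y \in M) = (gmap g f y \in L)) ->
  poisson_rel M (f x) xi <-> poisson_rel L x (xi \o f)%VF.
Proof.
have fC (y : V) : hom_cplx f (cplx_of y) = cplx_of (f y).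
  by rewrite hom_cplxE /= linear0.
have gC (y : W) : hom_cplx g (cplx_of y) = cplx_of (g y).
  by rewrite hom_cplxE /= linear0.
move=> ME; split=> [[be []]|[al [alL alE]]].
  rewrite ME /gmap /= gC fK => beL beE; exists (be \o hom_cplx f)%VF.
  by split=> // v; rewrite !comp_lfunE fC beE.
exists (al \o hom_cplx g)%VF; split; last first.
  by move=> v; rewrite comp_lfunE gC alE comp_lfunE gK.
by rewrite ME -fC -[(_, _)]/(gmap f g (cplx_of x, al)) gmapK.
Qed.

Lemma gmap_pushforward (L : {vspace gvec (cplx V)})
    (M : {vspace gvec (cplx W)}) :
  (forall y, (y \in M) = (gmap g f y \in L)) ->
  pushforward f [set` L] = [set` M].
Proof.
move=> ME; apply/seteqP; split=> -[u be] /=.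
  move=> [X [/= XL ->]]; rewrite ME.
  by rewrite /gmap /= (hom_cplxK fK).
rewrite ME => uL; exists (hom_cplx g u); split=> //=.
by rewrite (hom_cplxK gK).
Qed.

End Transport.

(** * Poisson morphisms as maps of graphs, and the equivalence *)

Lemma bijective_hom_inv (K : fieldType) (V W : vectType K) (f : 'Hom(V, W)) :
  bijective f -> cancel f (f^-1)%VF /\ cancel (f^-1)%VF f.
Proof.
move=> [h fK hK]; have kf : lker f == 0%VS by apply/lker0P; exact: can_inj fK.
split; first exact: lker0_lfunK.
by move=> y; rewrite limg_lfunVK // -[y]hK memv_img ?memvf.
Qed.

(** Both bivectors are determined by their graphs, so the condition says that f sends pi_V(f^* xi,
    .) to pi_W(xi, .). *)
Lemma poisson_morphismP (R : rcfType) (V W : vectType R) (f : 'Hom(V, W))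
    (LV : {vspace gvec (cplx V)}) (LW : {vspace gvec (cplx W)}) :
  bijective f -> gen_complex LV -> gen_complex LW ->
  poisson_morphism f LV LW <->
  forall x xi, poisson_rel LV x (xi \o f)%VF <-> poisson_rel LW (f x) xi.
Proof.
move=> /bijective_hom_inv[fK gK] gcV gcW; split=> [|PVW].
  move=> [piV [piW [/(poisson_ofP gcV)[_ pV] /(poisson_ofP gcW)[_ pW] pVW]]].
  move=> x xi; rewrite -pV -pW; split=> h eta /=.
    by rewrite -pVW /bivector_pushforward -h /= comp_lfunE.
  (* As [f] is invertible, every covector on V is a pullback from W. *)
  have etaE : eta = ((eta \o f^-1) \o f)%VF.
    by apply/lfunP => v; rewrite !comp_lfunE /= fK.
  rewrite [in RHS]etaE -[RHS]/(bivector_pushforward f piV xi _) pVW -h.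
  by rewrite comp_lfunE /= fK.
have [piV [piVA pV]] := exists_poisson_bivector gcV.
have [piW [piWA pW]] := exists_poisson_bivector gcW.
exists piV, piW; split; [exact/(poisson_ofP gcV)|exact/(poisson_ofP gcW)|].
move=> xi eta; have [x xr] := poisson_rel_total gcV (xi \o f)%VF.
have /pW <- := (PVW _ _).1 xr.
by rewrite /bivector_pushforward -((pV _ _).2 xr) /= comp_lfunE.
Qed.

Theorem corollary3p3 (R : realType) (V W : vectType R) (f : 'Hom(V, W))
    (LV : {vspace gvec (cplx V)}) (LW : {vspace gvec (cplx W)}) :
  bijective f -> gen_complex LV -> gen_complex LW ->
  gen_complex_linear f LV LW <->
  exists b : bilform W,
    alternating b /\ exp_form b @` pushforward f [set` LV] = [set` LW].
Proof.
move=> fbij gcV gcW; have [fK gK] := bijective_hom_inv fbij.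
(* [M] is f_*(LV) as a subspace, so the comparison takes place between [M] and [LW], both over W. *)
have [M ME] := gmap_vspace (f^-1)%VF f LV.
have gcM := gmap_gen_complex fK gK gcV ME.
have PM x xi := gmap_poisson_rel fK gK x xi ME.
rewrite (gmap_pushforward fK gK ME); split.
  move=> [[EV [EW [/(coCR_ofP gcV) -> /(coCR_ofP gcW) ->]]]].
  rewrite -(gmap_anchor fK gK ME) => sMW.
  move=> /(poisson_morphismP fbij gcV gcW) PVW.
  apply: same_poisson_bfield => // y xi.
  by rewrite -[y]gK PM PVW.
move=> [b [bA Mb]]; split.
  exists (anchor LV), (anchor LW).
  split; [exact/(coCR_ofP gcV)|exact/(coCR_ofP gcW)|].
  by rewrite -(gmap_anchor fK gK ME) (exp_form_anchor Mb).
apply/(poisson_morphismP fbij gcV gcW) => x xi.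
by rewrite -PM; exact: exp_form_poisson_rel Mb.
Qed.
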